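(* Let $\rho_T(y|z)$ be the conditional density of $y=T(x,z)$ given $z$, let $\nu(z)$ be the density of $z$, and let $\rho_T(y,z)=\rho_T(y|z)\nu(z)$. For a test function $F(y,z)$ put $E_z[F](y)=\int F(y,w)\,\nu(w)\,dw$ and $$L_F=\int \left(F(y,z)-E_z[F](y)\right)\rho_T(y,z)\,dy\,dz .$$ If $F(y,z)=\rho_T(y|z)$, then $L_F$ is always strictly positive unless $\rho_T(y|z)$ is independent of $z$.
   Context: Setting: $\rho(x|z)$ is a conditional probability distribution, where $z$ is distributed according to $\nu(z)$; $T(x,z)$ is a $z$-dependent map; and $\rho_T(\cdot|z)=T(\cdot,z)\#\rho(\cdot|z)$ is the push-forward of $\rho(\cdot|z)$ under $T(\cdot,z)$, written as a density in $y$. *)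

(* Defs.v *)
From HB Require Import structures.
From mathcomp Require Import all_boot all_order all_algebra.
From mathcomp Require Import all_classical all_reals all_analysis.

Set Implicit Arguments.
Unset Strict Implicit.
Unset Printing Implicit Defensive.

Import Order.TTheory GRing.Theory Num.Theory.
Import numFieldNormedType.Exports.

Local Open Scope classical_set_scope.
Local Open Scope ring_scope.
Local Open Scope ereal_scope.

(* The reference measures muY and muZ play the roles of
   "dy" and "dz" (Lebesgue measure in the Euclidean case, counting measure for
   a discrete variable, ...); all densities are relative to them. *)

Definition is_density d (Z : measurableType d) (R : realType)
    (mu : {measure set Z -> \bar R}) (nu : Z -> R) : Prop :=
  [/\ measurable_fun setT nu,
      forall z, (0 <= nu z)%R &
      \int[mu]_z (nu z)%:E = 1].

(* y |-> rhoT y z is the density of T(., z) # rho(. | z).  Conditional laws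
   matter only for almost every z under the law nu(z) dz, hence the
   quantification "for muZ-almost every z with nu z > 0". *)
Definition is_pushforward_conditional_density dX dY dZ
    (X : measurableType dX) (Y : measurableType dY) (Z : measurableType dZ)
    (R : realType)
    (muY : {measure set Y -> \bar R}) (muZ : {measure set Z -> \bar R})
    (nu : Z -> R) (rho : R.-pker Z ~> X) (T : X -> Z -> Y)
    (rhoT : Y -> Z -> R) : Prop :=
  [/\ measurable_fun setT (fun p : Y * Z => rhoT p.1 p.2),
      forall y z, (0 <= rhoT y z)%R &
      {ae muZ, forall z, (0 < nu z)%R -> forall B : set Y, measurable B ->
        pushforward (rho z) (T ^~ z) B = \int[muY]_(y in B) (rhoT y z)%:E}].

Definition joint_density Y Z (R : realType) (nu : Z -> R)
  (rhoT : Y -> Z -> R) (y : Y) (z : Z) : R := (rhoT y z * nu z)%R.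

(* Extended-real valued: for nonnegative F the integral may be +oo. *)
Definition E_z dZ Y (Z : measurableType dZ) (R : realType)
    (muZ : {measure set Z -> \bar R}) (nu : Z -> R)
    (F : Y -> Z -> R) (y : Y) : \bar R :=
  \int[muZ]_w (F y w * nu w)%:E.

Definition L_integrand dZ Y (Z : measurableType dZ) (R : realType)
    (muZ : {measure set Z -> \bar R}) (nu : Z -> R) (rhoT : Y -> Z -> R)
    (F : Y -> Z -> R) (p : Y * Z) : \bar R :=
  ((F p.1 p.2)%:E - E_z muZ nu F p.1) * (joint_density nu rhoT p.1 p.2)%:E.

Definition L dY dZ (Y : measurableType dY) (Z : measurableType dZ)
    (R : realType)
    (muY : {sigma_finite_measure set Y -> \bar R})
    (muZ : {sigma_finite_measure set Z -> \bar R})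
    (nu : Z -> R) (rhoT : Y -> Z -> R) (F : Y -> Z -> R) : \bar R :=
  \int[muY \x muZ]_p L_integrand muZ nu rhoT F p.

(* The integral defining L_F makes sense in [-oo, +oo], i.e. is not of the form
   +oo - +oo (to which the library assigns the value -oo). *)
Definition L_well_defined dY dZ (Y : measurableType dY) (Z : measurableType dZ)
    (R : realType)
    (muY : {sigma_finite_measure set Y -> \bar R})
    (muZ : {sigma_finite_measure set Z -> \bar R})
    (nu : Z -> R) (rhoT : Y -> Z -> R) (F : Y -> Z -> R) : Prop :=
  \int[muY \x muZ]_p (L_integrand muZ nu rhoT F)^\+ p < +oo \/
  \int[muY \x muZ]_p (L_integrand muZ nu rhoT F)^\- p < +oo.

(* Densities being defined only up to null sets, independence of z means that
   for almost every z (under nu(z) dz) the density rhoT(. | z) is almost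
   everywhere equal to one fixed function g. *)
Definition independent_of_z dY dZ (Y : measurableType dY)
    (Z : measurableType dZ) (R : realType)
    (muY : {measure set Y -> \bar R}) (muZ : {measure set Z -> \bar R})
    (nu : Z -> R) (rhoT : Y -> Z -> R) : Prop :=
  exists g : Y -> R,
    {ae muZ, forall z, (0 < nu z)%R -> {ae muY, forall y, rhoT y z = g y}}.

(* Main.v *)
(* Write m y = E_z[rhoT](y), the mean of rhoT(y | .) under nu.  The mean of
   rhoT(y | .) - m y is zero, so one may subtract (rhoT - m) m nu from the
   integrand of L, which gives
     L = \int (rhoT(y | z) - m y)^2 nu(z) dy dz.
   This is nonnegative, and it vanishes exactly when rhoT(y | z) = m y almost
   everywhere on {nu > 0}.  No integrability of (rhoT - m) m nu in y is
   available, so the identity is proved for each y in the form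
   "positive part = negative part + variance", where m y is finite since
   m integrates to 1, and then integrated in y by Tonelli. *)
Require Import Defs.
From HB Require Import structures.
From mathcomp Require Import all_boot all_order all_algebra.
From mathcomp Require Import all_classical all_reals all_analysis.
From mathcomp Require Import measurable_realfun ring lra.

Set Implicit Arguments.
Unset Strict Implicit.
Unset Printing Implicit Defensive.

Import Order.TTheory GRing.Theory Num.Theory.
Import numFieldNormedType.Exports.

Local Open Scope classical_set_scope.
Local Open Scope ring_scope.
Local Open Scope ereal_scope.

(** * Vanishing integrals of nonnegative functions, on one space and on a product *)

Lemma ge0_integral_eq0 d (S : measurableType d) (R : realType)
    (mu : {measure set S -> \bar R}) (h : S -> \bar R) :
  measurable_fun setT h -> (forall x, 0 <= h x) ->
  \int[mu]_x h x = 0 <-> {ae mu, forall x, h x = 0}.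
Proof.
move=> mh h0.
have -> : \int[mu]_x h x = \int[mu]_x `|h x|.
  by apply: eq_integral => x _; rewrite gee0_abs.
rewrite ae_eq_integral_abs//; split => [|] hae.
  by apply: filterS hae => x /(_ I).
by apply: filterS hae => x + _.
Qed.

(** With its mirror image below, this allows two nested almost-everywhere quantifiers to be swapped:
    by Tonelli, both orders are equivalent to the vanishing of one product integral. *)
Lemma ge0_integral_prod_eq0_xy d1 d2 (S1 : measurableType d1)
    (S2 : measurableType d2) (R : realType)
    (m1 : {sigma_finite_measure set S1 -> \bar R})
    (m2 : {sigma_finite_measure set S2 -> \bar R}) (h : S1 * S2 -> \bar R) :
  measurable_fun setT h -> (forall p, 0 <= h p) ->
  \int[m1 \x m2]_p h p = 0 <->
  {ae m1, forall x, {ae m2, forall y, h (x, y) = 0}}.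
Proof.
move=> mh h0; rewrite fubini_tonelli1// ge0_integral_eq0; last 2 first.
- exact: measurable_fun_fubini_tonelli_F.
- by move=> x; apply: integral_ge0.
have E x : fubini_F m2 h x = 0 <-> {ae m2, forall y, h (x, y) = 0}.
  by apply: ge0_integral_eq0 => //; exact: measurableT_comp.
by split; apply: filterS => x /E.
Qed.

Lemma ge0_integral_prod_eq0_yx d1 d2 (S1 : measurableType d1)
    (S2 : measurableType d2) (R : realType)
    (m1 : {sigma_finite_measure set S1 -> \bar R})
    (m2 : {sigma_finite_measure set S2 -> \bar R}) (h : S1 * S2 -> \bar R) :
  measurable_fun setT h -> (forall p, 0 <= h p) ->
  \int[m1 \x m2]_p h p = 0 <->
  {ae m2, forall y, {ae m1, forall x, h (x, y) = 0}}.
Proof.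
move=> mh h0; rewrite fubini_tonelli2// ge0_integral_eq0; last 2 first.
- exact: measurable_fun_fubini_tonelli_G.
- by move=> x; apply: integral_ge0.
have E y : fubini_G m1 h y = 0 <-> {ae m1, forall x, h (x, y) = 0}.
  by apply: ge0_integral_eq0 => //; exact: measurableT_comp.
by split; apply: filterS => y /E.
Qed.

(** * The variance identity for a single function of [z] *)

Lemma measurable_max0M d (Z : measurableType d) (R : realType)
    (g nu : Z -> R) : measurable_fun setT g -> measurable_fun setT nu ->
  measurable_fun setT (fun z => (Num.max (g z) 0 * nu z)%:E).
Proof.
move=> mg mnu; apply/measurable_EFinP; apply: measurable_funM => //.
exact: measurable_maxr.
Qed.

Lemma max0M_ge0 (R : realDomainType) (x y : R) :
  (0 <= y)%R -> 0 <= (Num.max x 0 * y)%:E.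
Proof. by move=> y0; rewrite lee_fin mulr_ge0// le_max lexx orbT. Qed.

(** Since [phi - c] has mean zero under [nu], its positive and negative parts balance. *)
Lemma integral_mean_posneg_eq d (Z : measurableType d) (R : realType)
    (mu : {measure set Z -> \bar R}) (nu phi : Z -> R) (c : R) :
  is_density mu nu -> measurable_fun setT phi -> (forall z, 0 <= phi z)%R ->
  \int[mu]_z (phi z * nu z)%:E = c%:E ->
  \int[mu]_z (Num.max (c - phi z) 0 * nu z)%:E =
  \int[mu]_z (Num.max (phi z - c) 0 * nu z)%:E.
Proof.
move=> [mnu nu0 nu1] mphi phi0 phic.
have c0 : (0 <= c)%R.
  by rewrite -lee_fin -phic; apply: integral_ge0 => z _; rewrite lee_fin mulr_ge0.
have mphinu : measurable_fun setT (fun z => (phi z * nu z)%:E).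
  by apply/measurable_EFinP; exact: measurable_funM.
have mcnu : measurable_fun setT (fun z => c%:E * (nu z)%:E).
  by apply/measurable_EFinP; exact: measurable_funM.
suff : \int[mu]_z (Num.max (c - phi z) 0 * nu z)%:E + c%:E =
       \int[mu]_z (Num.max (phi z - c) 0 * nu z)%:E + c%:E.
  by move/(congr1 (fun t => t - c%:E)); rewrite !addeK.
have cE : \int[mu]_z (c%:E * (nu z)%:E) = c%:E.
  rewrite ge0_integralZl_EFin ?nu1 ?mule1//; last exact/measurable_EFinP.
  by move=> z _; rewrite lee_fin.
(* The left [c] is read as the mean of [phi], the right one as [c] times the mass of [nu]; both
   integrands then equal [max (phi z) c * nu z]. *)
rewrite -[in LHS]phic -[in X in _ = _ + X]cE -!ge0_integralD//=.
- apply: eq_integral => z _; rewrite -EFinM -!EFinD; congr EFin.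
  have [?|?] := lerP (c - phi z) 0; have [?|?] := lerP (phi z - c) 0; try ring.
  - by have -> : phi z = c by lra.
  - lra.
- by move=> z _; exact: max0M_ge0.
- by apply: measurable_max0M => //; exact: measurable_funB.
- by move=> z _; rewrite -EFinM lee_fin mulr_ge0.
- by move=> z _; exact: max0M_ge0.
- by apply: measurable_max0M => //; exact: measurable_funB.
- by move=> z _; rewrite lee_fin mulr_ge0.
Qed.

(* [(p - c) p n = (p - c)^2 n + c (p - c) n], every term being split into its
   positive and negative parts and moved to the side where it is nonnegative. *)
Lemma posneg_square_identity (R : realDomainType) (c p n : R) :
  (0 <= p -> 0 <= n ->
  Num.max ((p - c) * (p * n)) 0 + c * (Num.max (c - p) 0 * n) =
  Num.max (- ((p - c) * (p * n))) 0 + (p - c) ^+ 2 * n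
    + c * (Num.max (p - c) 0 * n))%R.
Proof.
move=> p0 n0; have pn0 : (0 <= p * n)%R by exact: mulr_ge0.
have [pc|/ltW cp] := leP p c.
- have h : ((p - c) * (p * n) <= 0)%R by apply: mulr_le0_ge0; rewrite // subr_le0.
  rewrite (max_r h) (@max_l _ _ (c - p)%R) ?subr_ge0//.
  rewrite (@max_l _ _ (- _)%R) ?oppr_ge0// (@max_r _ _ (p - c)%R) ?subr_le0//.
  ring.
- have h : (0 <= (p - c) * (p * n))%R by apply: mulr_ge0; rewrite // subr_ge0.
  rewrite (max_l h) (@max_r _ _ (c - p)%R) ?subr_le0//.
  rewrite (@max_r _ _ (- _)%R) ?oppr_le0// (@max_l _ _ (p - c)%R) ?subr_ge0//.
  ring.
Qed.

(** This is [posneg_square_identity] integrated: its two terms with factor [c] have equal finite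
    integrals and cancel. The parts of [h] may have infinite integrals, hence a sum on the right and
    no difference. *)
Lemma integral_funepos_deviation d (Z : measurableType d) (R : realType)
    (mu : {measure set Z -> \bar R}) (nu phi : Z -> R) (c : R) :
  is_density mu nu -> measurable_fun setT phi -> (forall z, 0 <= phi z)%R ->
  \int[mu]_z (phi z * nu z)%:E = c%:E ->
  let h z := ((phi z - c) * (phi z * nu z))%:E in
  \int[mu]_z h^\+ z =
  \int[mu]_z h^\- z + \int[mu]_z ((phi z - c) ^+ 2 * nu z)%:E.
Proof.
move=> dnu mphi phi0 phic h; have [mnu nu0 nu1] := dnu.
have c0 : (0 <= c)%R.
  by rewrite -lee_fin -phic; apply: integral_ge0 => z _; rewrite lee_fin mulr_ge0.
have negpart0 z : 0 <= (Num.max (c - phi z) 0 * nu z)%:E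
  by exact: max0M_ge0.
have pospart0 z : 0 <= (Num.max (phi z - c) 0 * nu z)%:E
  by exact: max0M_ge0.
have mphic : measurable_fun setT (fun z => phi z - c)%R.
  exact: measurable_funB.
have mcphi : measurable_fun setT (fun z => c - phi z)%R.
  exact: measurable_funB.
have mh : measurable_fun setT h.
  by apply/measurable_EFinP; apply: measurable_funM => //; exact: measurable_funM.
have msq : measurable_fun setT (fun z => ((phi z - c) ^+ 2 * nu z)%:E).
  apply/measurable_EFinP; apply: measurable_funM => //.
  exact: measurable_funX.
have sq0 z : 0 <= ((phi z - c) ^+ 2 * nu z)%:E.
  by rewrite lee_fin mulr_ge0// sqr_ge0.
have meanE := integral_mean_posneg_eq dnu mphi phi0 phic.
(* As [phi] is nonnegative, [max (c - phi z) 0 <= c], so the integral is at most [c]. *)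
have mean_fin : c%:E * \int[mu]_z (Num.max (c - phi z) 0 * nu z)%:E \is a fin_num.
  apply: fin_numM => //; rewrite ge0_fin_numE ?integral_ge0//.
  apply: (@le_lt_trans _ _ (\int[mu]_z (c%:E * (nu z)%:E))); last first.
    rewrite ge0_integralZl_EFin ?nu1 ?mule1 ?ltry//; last exact/measurable_EFinP.
    by move=> z _; rewrite lee_fin.
  apply: ge0_le_integral => //.
  - exact: measurable_max0M.
  - by apply/measurable_EFinP; exact: measurable_funM.
  - move=> z _; rewrite -EFinM lee_fin ler_wpM2r// ge_max c0 andbT.
    by rewrite gerBl.
suff : \int[mu]_z h^\+ z + c%:E * \int[mu]_z (Num.max (c - phi z) 0 * nu z)%:E
    = \int[mu]_z h^\- z + \int[mu]_z ((phi z - c) ^+ 2 * nu z)%:E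
      + c%:E * \int[mu]_z (Num.max (c - phi z) 0 * nu z)%:E.
  move/(congr1 (fun t =>
    t - c%:E * \int[mu]_z (Num.max (c - phi z) 0 * nu z)%:E)).
  by rewrite !addeK.
have mZ (g : Z -> R) : measurable_fun setT g ->
    measurable_fun setT (fun z => c%:E * (Num.max (g z) 0 * nu z)%:E).
  by move=> mg; apply: emeasurable_funM => //; exact: measurable_max0M.
(* Only the right-hand side passes to [max (phi z - c) 0]; the integrands then match
   [posneg_square_identity]. *)
rewrite [in RHS]meanE -!ge0_integralZl_EFin//;
  [|exact: measurable_max0M|exact: measurable_max0M].
rewrite -!ge0_integralD//; first last.
- exact: mZ.
- by move=> z _; apply: mule_ge0.
- exact: measurable_funepos.
- exact: measurable_funeneg.
- exact: mZ.
- by move=> z _; apply: mule_ge0.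
- by apply: emeasurable_funD => //; exact: measurable_funeneg.
- by move=> z _; rewrite adde_ge0// funeneg_ge0.
apply: eq_integral => z _; rewrite funeposE funenegE /h -EFinN.
rewrite -[0]/(0%R%:E) -!EFin_max -!EFinM -!EFinD.
by rewrite posneg_square_identity.
Qed.

(** * [L] as the integral of the squared deviation from the mean over [z] *)

Section sq_deviation.
Context {R : realType} {dY dZ : measure_display}
  {Y : measurableType dY} {Z : measurableType dZ}
  (muY : {sigma_finite_measure set Y -> \bar R})
  (muZ : {sigma_finite_measure set Z -> \bar R})
  (nu : Z -> R) (f : Y -> Z -> R).

(** Where the mean is [+oo], [fine] replaces it by 0; by [ae_E_z_fin_num] this concerns only a null
    set of [y]. *)
Definition sq_deviation (p : Y * Z) : \bar R :=
  ((f p.1 p.2 - fine (E_z muZ nu f p.1)) ^+ 2 * nu p.2)%:E.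

Hypothesis nu_density : is_density muZ nu.
Hypothesis mf : measurable_fun setT (fun p : Y * Z => f p.1 p.2).
Hypothesis f0 : forall y z, (0 <= f y z)%R.
Hypothesis mass1 : {ae muZ, forall z, (0 < nu z)%R ->
  \int[muY]_y (f y z)%:E = 1}.

Let mnu2 : measurable_fun setT (fun p : Y * Z => nu p.2).
Proof. by case: nu_density => mnu _ _; exact: measurableT_comp. Qed.

Let mjoint : measurable_fun setT (fun p : Y * Z => (f p.1 p.2 * nu p.2)%:E).
Proof. by apply/measurable_EFinP; exact: measurable_funM. Qed.

Let joint0 (p : Y * Z) : 0 <= (f p.1 p.2 * nu p.2)%:E.
Proof. by case: nu_density => _ nu0 _; rewrite lee_fin mulr_ge0. Qed.

Lemma measurable_E_z : measurable_fun setT (E_z muZ nu f).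
Proof. exact: (measurable_fun_fubini_tonelli_F _ mjoint joint0). Qed.

Lemma measurable_L_integrand :
  measurable_fun setT (L_integrand muZ nu f f).
Proof.
apply: emeasurable_funM => //; apply: emeasurable_funB.
  exact/measurable_EFinP.
by apply: measurableT_comp => //; exact: measurable_E_z.
Qed.

Lemma measurable_sq_deviation : measurable_fun setT sq_deviation.
Proof.
apply/measurable_EFinP; apply: measurable_funM => //.
apply: measurable_funX; apply: measurable_funB => //.
apply: measurableT_comp => //; apply: measurableT_comp => //.
exact: measurable_E_z.
Qed.

Lemma sq_deviation_ge0 p : 0 <= sq_deviation p.
Proof. by case: nu_density => _ nu0 _; rewrite lee_fin mulr_ge0// sqr_ge0. Qed.

(** By Tonelli the mean integrates over [y] to the mass of [nu], which is 1, and an integrable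
    function is finite almost everywhere. *)
Lemma ae_E_z_fin_num : {ae muY, forall y, E_z muZ nu f y \is a fin_num}.
Proof.
have [mnu nu0 nu1] := nu_density.
have E_z0 y : 0 <= E_z muZ nu f y.
  by apply: integral_ge0 => z _; exact: (joint0 (y, z)).
suff iE : muY.-integrable setT (E_z muZ nu f).
  by have := integrable_ae measurableT iE; apply: filterS => y; exact.
apply/integrableP; split; first exact: measurable_E_z.
under eq_integral do rewrite gee0_abs//.
rewrite (fubini_tonelli (fun p : Y * Z => (f p.1 p.2 * nu p.2)%:E))//=.
rewrite (@ge0_ae_eq_integral _ _ _ _ _ _ (EFin \o nu))//.
- by rewrite nu1 ltry.
- exact: (measurable_fun_fubini_tonelli_G _ mjoint joint0).
- exact/measurable_EFinP.
- by move=> z _; apply: integral_ge0 => y _; exact: (joint0 (y, z)).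
- by move=> z _; rewrite lee_fin.
apply: filterS mass1 => z mass _ /=.
under eq_integral do rewrite EFinM.
rewrite ge0_integralZr//; last 3 first.
- by apply/measurable_EFinP; exact: (measurableT_comp mf (pair2_measurable z)).
- by move=> y _; rewrite lee_fin.
- by rewrite lee_fin.
(* Where [nu z = 0] the slice may have any mass, even [+oo]; the convention that [+oo * 0] is 0
   settles this case. *)
have := nu0 z; rewrite le_eqVlt => /orP[/eqP <-|nuz];
  first by rewrite mule0.
by rewrite mass// mul1e.
Qed.

Lemma L_eq_integral_sq_deviation : L_well_defined muY muZ nu f f ->
  L muY muZ nu f f = \int[muY \x muZ]_p sq_deviation p.
Proof.
move=> wd.
have mp : measurable_fun setT (L_integrand muZ nu f f)^\+.
  by apply: measurable_funepos; exact: measurable_L_integrand.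
have mn : measurable_fun setT (L_integrand muZ nu f f)^\-.
  by apply: measurable_funeneg; exact: measurable_L_integrand.
have msq := measurable_sq_deviation.
have sq0 := sq_deviation_ge0.
have posE : \int[muY \x muZ]_p (L_integrand muZ nu f f)^\+ p =
    \int[muY \x muZ]_p (L_integrand muZ nu f f)^\- p +
    \int[muY \x muZ]_p sq_deviation p.
  rewrite -ge0_integralD//.
  rewrite !fubini_tonelli1//; last 2 first.
  - exact: emeasurable_funD.
  - by move=> p; rewrite adde_ge0.
  apply: ge0_ae_eq_integral => //.
  - exact: measurable_fun_fubini_tonelli_F.
  - apply: measurable_fun_fubini_tonelli_F; first exact: emeasurable_funD.
    by move=> p; rewrite adde_ge0.
  - by move=> y _; apply: integral_ge0.
  - by move=> y _; apply: integral_ge0 => z _; rewrite adde_ge0.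
  (* For fixed [y] with finite mean, the one-variable identity applies to the slice [f y] with [c]
     equal to that mean. *)
  apply: filterS ae_E_z_fin_num => y /fineK Ey _.
  rewrite /fubini_F ge0_integralD//; last 2 first.
  - exact: measurableT_comp.
  - exact: measurableT_comp.
  have hE : (fun z =>
      ((f y z - fine (E_z muZ nu f y)) * (f y z * nu z))%:E) =
      L_integrand muZ nu f f \o pair y.
    by apply: funext => z; rewrite /L_integrand /= -[in RHS]Ey.
  have := integral_funepos_deviation nu_density
    (measurableT_comp mf (pair1_measurable y)) (f0 y) (esym Ey).
  rewrite /= hE; under eq_integral do rewrite funeposE.
  under [in X in _ = X + _ -> _]eq_integral do rewrite funenegE.
  under [in X in _ -> X = _]eq_integral do rewrite funeposE.
  by under [in X in _ -> _ = X + _]eq_integral do rewrite funenegE.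
rewrite /L integralE posE.
(* By [posE] the negative part has the smaller integral, so it is finite in either case of
   [L_well_defined] and may be subtracted. *)
have sum0 : \int[muY \x muZ]_p (L_integrand muZ nu f f)^\- p \is a fin_num.
  rewrite ge0_fin_numE ?integral_ge0//; case: wd => //.
  by rewrite posE; apply: le_lt_trans; rewrite leeDl// integral_ge0.
by rewrite addeAC subee// add0e.
Qed.

(** * Independence of [z] as vanishing of the squared deviation *)

Lemma sq_deviation_eq0 y z : sq_deviation (y, z) = 0 <->
  ((0 < nu z)%R -> f y z = fine (E_z muZ nu f y)).
Proof.
case: nu_density => _ nu0 _; have := nu0 z.
rewrite le_eqVlt /sq_deviation /= => /orP[/eqP <-|nuz].
  by rewrite mulr0; split=> // _; rewrite ltxx.
split=> [/eqP + _|->//]; last by rewrite subrr expr0n mul0r.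
by rewrite eqe mulf_eq0 (gt_eqF nuz) orbF expf_eq0/= subr_eq0 => /eqP.
Qed.

(* The [g] of [independent_of_z] need not be measurable; a slice of [f] is. *)
Lemma ae_indep_representative : independent_of_z muY muZ nu f ->
  exists z0, {ae muZ, forall z, (0 < nu z)%R ->
    {ae muY, forall y, f y z = f y z0}}.
Proof.
move=> [g gP]; have [mnu nu0 nu1] := nu_density.
have [[z0 [nuz0 gz0]]|noz0] :=
    pselect (exists z0, (0 < nu z0)%R /\ {ae muY, forall y, f y z0 = g y}).
  exists z0; apply: filterS gP => z gz nuz.
  by apply: filterS2 (gz nuz) gz0 => y -> ->.
(* Without such a [z0], [gP] would force [nu] to vanish almost everywhere, against its total mass
   1. *)
have : \int[muZ]_z (nu z)%:E = 0.
  apply/ge0_integral_eq0; first exact/measurable_EFinP.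
    by move=> z; rewrite lee_fin.
  apply: filterS gP => z gz; have := nu0 z.
  rewrite le_eqVlt => /orP[/eqP <-//|nuz].
  by exfalso; apply: noz0; exists z; split=> //; exact: gz.
by rewrite nu1 => /eqP; rewrite onee_eq0.
Qed.

(** A density that does not depend on [z] coincides with its own mean. Independence fixes [z] first
    and then almost every [y], while computing the mean fixes [y] first; the quantifiers are
    therefore swapped twice. *)
Lemma independent_of_zP : independent_of_z muY muZ nu f <->
  \int[muY \x muZ]_p sq_deviation p = 0.
Proof.
have [mnu nu0 nu1] := nu_density.
split=> [/ae_indep_representative [z0 z0P]|]; last first.
  rewrite ge0_integral_prod_eq0_yx;
    [|exact: measurable_sq_deviation|exact: sq_deviation_ge0].
  move=> sq0; exists (fun y => fine (E_z muZ nu f y)).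
  apply: filterS sq0 => z sq0 nuz; apply: filterS sq0 => y.
  by move=> /sq_deviation_eq0; exact.
(* [k] vanishes exactly where [nu] does or [f] agrees with the slice at [z0]; being measurable and
   nonnegative, it carries the swap. *)
pose k (p : Y * Z) := (`|f p.1 p.2 - f p.1 z0| * nu p.2)%:E.
have mk : measurable_fun setT k.
  apply/measurable_EFinP; apply: measurable_funM => //.
  apply: measurableT_comp => //; apply: measurable_funB => //.
  exact: (measurableT_comp (measurableT_comp mf (pair2_measurable z0))).
have k0 p : 0 <= k p by rewrite lee_fin mulr_ge0.
have : \int[muY \x muZ]_p k p = 0.
  apply/ge0_integral_prod_eq0_yx => //; apply: filterS z0P => z zP.
  have := nu0 z; rewrite le_eqVlt => /orP[/eqP nuz|/zP].
    by apply: nearW => y; rewrite /k /= -nuz mulr0.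
  by apply: filterS => y; rewrite /k /= => ->; rewrite subrr normr0 mul0r.
move/(ge0_integral_prod_eq0_xy _ _ mk k0) => kae.
(* For almost every [y], the slice [f y] equals the constant [f y z0] almost everywhere on [nu > 0],
   and [nu] has mass 1. *)
have EzE : {ae muY, forall y, E_z muZ nu f y = (f y z0)%:E}.
  apply: filterS kae => y ky.
  transitivity (\int[muZ]_z ((f y z0)%:E * (nu z)%:E)); last first.
    rewrite ge0_integralZl_EFin ?nu1 ?mule1//; last exact/measurable_EFinP.
    by move=> z _; rewrite lee_fin.
  apply: ge0_ae_eq_integral => //.
  - exact: (measurableT_comp mjoint (pair1_measurable y)).
  - by apply/measurable_EFinP; exact: measurable_funM.
  - by move=> z _; exact: (joint0 (y, z)).
  - by move=> z _; rewrite -EFinM lee_fin mulr_ge0.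
  apply: filterS ky => z /eqP + _; rewrite /k /= eqe mulf_eq0 normr_eq0 subr_eq0.
  by rewrite -EFinM => /orP[/eqP ->|/eqP ->]; rewrite ?mulr0.
apply/ge0_integral_prod_eq0_yx;
  [exact: measurable_sq_deviation|exact: sq_deviation_ge0|].
(* Back in the order [z] first, both [f y z] and the mean equal [f y z0]. *)
apply: filterS z0P => z zP; have [nuz|nuz] := ltP 0%R (nu z).
  apply: filterS2 (zP nuz) EzE => y fyz Ey.
  by apply/sq_deviation_eq0 => _; rewrite Ey fyz.
by apply: nearW => y; apply/sq_deviation_eq0; rewrite ltNge nuz.
Qed.

End sq_deviation.

(** * Strict positivity of [L] as non-vanishing of a nonnegative integral *)

Theorem proposition1 (R : realType) (dX dY dZ : measure_display)
  (X : measurableType dX) (Y : measurableType dY) (Z : measurableType dZ)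
  (muY : {sigma_finite_measure set Y -> \bar R})
  (muZ : {sigma_finite_measure set Z -> \bar R})
  (nu : Z -> R) (rho : R.-pker Z ~> X) (T : X -> Z -> Y) (rhoT : Y -> Z -> R)
  (nu_density : is_density muZ nu)
  (T_measurable : forall z : Z, measurable_fun [set: X] (fun x => T x z))
  (rhoT_density :
    is_pushforward_conditional_density muY muZ nu rho T rhoT)
  (L_defined : L_well_defined muY muZ nu rhoT rhoT) :
  0 < L muY muZ nu rhoT rhoT <-> ~ independent_of_z muY muZ nu rhoT.
Proof.
have [mrhoT rhoT0 pushE] := rhoT_density.
have mass1 : {ae muZ, forall z, (0 < nu z)%R ->
    \int[muY]_y (rhoT y z)%:E = 1}.
  (* With [B = setT], the push-forward keeps the mass 1 of the probability [rho z]. *)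
  apply: filterS pushE => z zE nuz.
  by rewrite -(zE nuz setT measurableT) /pushforward preimage_setT prob_kernel.
rewrite L_eq_integral_sq_deviation// independent_of_zP//.
have sq_ge0 : 0 <= \int[muY \x muZ]_p sq_deviation muZ nu rhoT p.
  by apply: integral_ge0 => p _; exact: sq_deviation_ge0.
by rewrite lt_def sq_ge0 andbT; split=> [/eqP|/eqP].
Qed.
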